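(* Let $\mathcal F$ be a convex Zhegalkin zebra function, $\Lambda\subset\mathrm{Aut}(\mathcal F)$ a sublattice, $\omega$ a realization of the superpotential $[\mathcal F]_\Lambda=(\mathcal E_\Lambda,\sigma_0,\sigma_1)$, $\theta$ a positive fractional matching, and $\mathsf m$ a perfect matching. View $\omega$ as an $|\mathcal E_\Lambda|\times2$-matrix (row $e$ being $\omega(e)$). Then, for every $e\in\mathcal E_\Lambda$, in the quadrangle of (a lift $\widetilde e$ of) $e$ with vertices $s(\widetilde e),t(\widetilde e),b(\widetilde e),w(\widetilde e)$: (i) the vector from $s(\widetilde e)$ to $b(\widetilde e)$ is the $e$-th row of the $|\mathcal E_\Lambda|\times 2$-matrix $(\mathbf B_{\mathsf m,\theta}+\mathbb I-\rho_{\mathsf m,1})\cdot\omega$; (ii) the vector from $s(\widetilde e)$ to $w(\widetilde e)$ is the $e$-th row of the $|\mathcal E_\Lambda|\times 2$-matrix $(\mathbf W_{\mathsf m,\theta}+\mathbb I-\rho_{\mathsf m,0})\cdot\omega$; (iii) the vector from $s(\widetilde e)$ to $t(\widetilde e)$ is the $e$-th row of $\omega$. (In particular this applies to a weight realization $(\nu_1,\nu_2,\nu_3)$, with $\omega=(\nu_1-\nu_3,\nu_2-\nu_3)$ and $\theta=\frac{1}{\deg\nu_3}\nu_3$.)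
   Context: **Zhegalkin zebra functions.** For $\mathfrak v\in\mathbb R^2\setminus\{0\}$ put $Z^{\mathfrak v}:\mathbb R^2\to\mathbb F_2$, $Z^{\mathfrak v}(x)=\lfloor 2\,x\cdot\mathfrak v\rfloor \bmod 2$. Identify $\mathbb R^2=\mathbb C$, let $\varepsilon=e^{\pi i/6}$ and $\mathfrak v_1=\sqrt3\varepsilon^5,\ \mathfrak v_2=\varepsilon^4,\ \mathfrak v_3=\sqrt3 i,\ \mathfrak v_4=\varepsilon^2,\ \mathfrak v_5=\sqrt3\varepsilon,\ \mathfrak v_6=1$. A Zhegalkin zebra function is an element $\mathcal F$ of the ring of $\mathbb F_2$-valued functions on $\mathbb R^2$ generated by the $Z^{k\mathfrak v_j}$ ($k\in\mathbb Z_{>0}$, $1\le j\le 6$). It gives a tiling of the plane by white ($\mathcal F=0$) and black ($\mathcal F=1$) polygons; $\mathcal F$ is convex if all these polygons are bounded and convex. $\mathrm{Aut}(\mathcal F)=\{\tau\in\mathbb R^2: \mathcal F(x+\tau)=\mathcal F(x)\ \forall x\}$ is then a lattice in $\mathbb R^2$; ''sublattice'' means of rank 2. **Superpotential.** Let $\mathcal E$ be the set of edges of the tiling (vertices are the points where at least four edges meet), each oriented so that boundaries of black polygons run clockwise and of white polygons counter-clockwise. For $e\in\mathcal E$ let $\sigma_0(e)$ (resp. $\sigma_1(e)$) be the edge following $e$ on the boundary of the white (resp. black) polygon adjacent to $e$. Let $\mathcal E_\Lambda=\mathcal E/\Lambda$ (finite), with induced permutations $\sigma_0,\sigma_1$;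 $[\mathcal F]_\Lambda=(\mathcal E_\Lambda,\sigma_0,\sigma_1)$ is the superpotential. The white polygons $P_\Lambda^\circ$ (black polygons $P_\Lambda^\bullet$) of the induced tiling of $\mathbb R^2/\Lambda$ correspond to the cycles of $\sigma_0$ (of $\sigma_1$); $w(e)$, $b(e)$ are the white and black polygon adjacent to $e\in\mathcal E_\Lambda$. **Weights.** An integer weight function is a map $\nu:\mathcal E_\Lambda\to\mathbb Z_{\ge0}$ whose sum over each cycle of $\sigma_0$ and each cycle of $\sigma_1$ equals one and the same integer $\deg\nu$. A perfect matching is an integer weight function of degree $1$. A positive fractional matching is a map $\theta:\mathcal E_\Lambda\to\mathbb R_{>0}$ whose sum over each cycle of $\sigma_0$ and each cycle of $\sigma_1$ equals $1$. **Realizations and quadrangles.** A realization of $[\mathcal F]_\Lambda$ is a map $\omega:\mathcal E_\Lambda\to\mathbb R^2\setminus\{0\}$ such that drawing each edge as the vector $\omega(e)$ (lifted to $\mathcal E$) gives a tiling of $\mathbb R^2$ by polygons with the same combinatorics (white/black polygons being the cycles of $\sigma_0$/$\sigma_1$, traversed counter-clockwise/clockwise), $\Lambda$ acting by a lattice of translations. In each polygon mark the convex combination, with coefficients $\theta(e)$, of the midpoints of its edges $e$. For an edge $\widetilde e$ of this tiling of $\mathbb R^2$, $s(\widetilde e)$ and $t(\widetilde e)$ are its source and target points and $b(\widetilde e)$, $w(\widetilde e)$ are the marked points in the adjacent black and white polygon; these four points are the vertices of the quadrangle of $\widetilde e$. A weight realization is a triple of positive-valued weight functions $(\nu_1,\nu_2,\nu_3)$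 such that $\omega=(\nu_1-\nu_3,\nu_2-\nu_3)$ is a realization for which all polygons and all quadrangles (with $\theta=\frac1{\deg\nu_3}\nu_3$) are strictly convex. **Matrices.** All square matrices have rows and columns indexed by $\mathcal E_\Lambda$; $\mathbb I$ is the identity. For $c=0,1$ write $\sigma_c$ as the permutation matrix whose column $e$ has its only non-zero entry, $1$, in row $\sigma_c(e)$. Multiplying, for every $e$, column $e$ by $1-\mathsf m(e)$ gives a nilpotent matrix $\varsigma_{\mathsf m,c}$; set $\rho_{\mathsf m,c}=(\mathbb I-\varsigma_{\mathsf m,c})^{-1}$. For a polygon $\mathbf p\in P_\Lambda^\bullet\cup P_\Lambda^\circ$ let $\beta_{\mathbf p}:\mathcal E_\Lambda\to\{0,1\}$ be the indicator function of the edges of $\mathbf p$. With $\theta$ a column vector, define $\mathbf B_{\mathsf m,\theta}$ and $\mathbf W_{\mathsf m,\theta}$ by $$e\text{-th row of }\mathbf B_{\mathsf m,\theta}=\theta^t\cdot\mathrm{diag}(\beta_{b(e)})\cdot(-\tfrac12\mathbb I+\rho_{\mathsf m,1}),\qquad e\text{-th row of }\mathbf W_{\mathsf m,\theta}=\theta^t\cdot\mathrm{diag}(\beta_{w(e)})\cdot(-\tfrac12\mathbb I+\rho_{\mathsf m,0}).$$ *)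

(* Defs.v *)
From HB Require Import structures.
From mathcomp Require Import all_boot all_order all_algebra all_fingroup.
From mathcomp Require Import all_classical all_reals all_analysis.
Import Order.TTheory GRing.Theory Num.Theory.
Import numFieldNormedType.Exports.

Set Implicit Arguments.
Unset Strict Implicit.
Unset Printing Implicit Defensive.

Local Open Scope classical_set_scope.
Local Open Scope ring_scope.

Notation plane R := 'rV[R]_2.

(* Colours are elements of 'F_2, as values of zebra functions and as indices
   of sigma and rho: 0 is white and 1 is black. *)
Notation color := 'F_2.

Section PlaneGeometry.
Variable R : realType.
Implicit Types u v p : plane R.

Definition vec2 (a b : R) : plane R := \row_(j < 2) (if j == 0 then a else b).

Definition dot u v : R := u 0 0 * v 0 0 + u 0 1 * v 0 1.

Definition cross u v : R := u 0 0 * v 0 1 - u 0 1 * v 0 0.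

(* The vector v turned by a quarter: to its left for c = 0, to its right for
   c = 1. *)
Definition edge_normal (c : color) v : plane R :=
  if c == 0 then vec2 (- v 0 1) (v 0 0) else vec2 (v 0 1) (- v 0 0).

Definition lattice (L : set (plane R)) : Prop :=
  exists a b, cross a b != 0 /\
    L = [set z | exists m n : int, z = a *~ m + b *~ n].

(* The vertices are listed in cyclic order, in either direction; the condition
   says that, for each side, all other vertices lie strictly on the same side
   of its line, this side being the left for all sides or the right for all. *)
Definition strictly_convex (l : seq (plane R)) : Prop :=
  (2 < size l)%N /\
  exists s : R, forall i k : nat,
    (i < size l)%N -> (k < size l)%N -> k <> i -> k <> (i.+1 %% size l)%N ->
    0 < s * cross (l`_(i.+1 %% size l) - l`_i) (l`_k - l`_i).

End PlaneGeometry.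

Section Zebra.
Variable R : realType.
Implicit Types (F : plane R -> 'F_2) (c : color) (P L : set (plane R)).

Definition zebra (v : plane R) : plane R -> 'F_2 :=
  fun x => (Num.floor (2 * dot x v))%:~R.

(* The k-th power of e^(pi i / 6), with R^2 identified with the complex
   numbers. *)
Definition eps_pow (k : nat) : plane R :=
  vec2 (cos (k%:R * pi / 6)) (sin (k%:R * pi / 6)).

Definition zebra_vectors : seq (plane R) :=
  [:: Num.sqrt 3 *: eps_pow 5; eps_pow 4; Num.sqrt 3 *: eps_pow 3;
      eps_pow 2; Num.sqrt 3 *: eps_pow 1; eps_pow 0].

Inductive zhegalkin : (plane R -> 'F_2) -> Prop :=
| Zhegalkin_gen (k : nat) (v : plane R) :
    (0 < k)%N -> v \in zebra_vectors -> zhegalkin (zebra (k%:R *: v))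
| Zhegalkin_one : zhegalkin (fun=> 1)
| Zhegalkin_sub F G :
    zhegalkin F -> zhegalkin G -> zhegalkin (fun x => F x - G x)
| Zhegalkin_mul F G :
    zhegalkin F -> zhegalkin G -> zhegalkin (fun x => F x * G x).

Definition region F c : set (plane R) := [set x | F x = c]°.

(* A polygon is represented by its interior, so that polygons of the same
   colour that touch at a vertex are distinct; the closed polygon is the
   closure. *)
Definition polygon F c P : Prop :=
  exists2 x, region F c x & P = connected_component (region F c) x.

Definition convex_zebra F : Prop :=
  forall c P, polygon F c P ->
    bounded_set P /\ convex_set (P : set (convex_lmodType (plane R))).

Definition Aut_zebra F : set (plane R) := [set tau | forall x, F (x + tau) = F x].

Definition sublattice F L : Prop := lattice L /\ L `<=` Aut_zebra F.

Definition border F : set (plane R) := ~` (region F 0 `|` region F 1).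

(* A point from which the border leaves in at least four directions *)
Definition vertex F : set (plane R) :=
  [set v | exists d : 'I_4 -> plane R,
     [/\ injective d, forall i, dot (d i) (d i) = 1 &
         forall i, \forall t \near 0^'+, border F (v + t *: d i)]].

(* An oriented edge is the pair of its source and its target. *)
Notation oriented := (plane R * plane R)%type.

Definition translate (tau : plane R) (x : oriented) : oriented :=
  (x.1 + tau, x.2 + tau).

(* The polygon P of colour c lies along x, on the left for white and on the
   right for black: so white boundaries run counter-clockwise and black ones
   run clockwise. *)
Definition adjacent F c (x : oriented) P : Prop :=
  polygon F c P /\
  forall r : R, 0 < r < 1 -> \forall h \near 0^'+,
    P (x.1 + r *: (x.2 - x.1) + h *: edge_normal c (x.2 - x.1)).

Definition edge F : set oriented :=
  [set x | [/\ vertex F x.1, vertex F x.2, x.1 <> x.2,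
     forall r : R, 0 < r < 1 ->
       (border F `\` vertex F) (x.1 + r *: (x.2 - x.1)) &
     forall c, exists P, adjacent F c x P]].

Definition follows F c (x y : oriented) : Prop :=
  [/\ edge F y, y.1 = x.2 & exists P, adjacent F c x P /\ adjacent F c y P].

(* sigma_c on the edges of the tiling of the plane; on the edges of a convex
   zebra function there is exactly one y with follows F c x y, and the default
   value of xget is not used. *)
Definition sigma_lift F c (x : oriented) : oriented := xget x (follows F c x).

Definition sigma_cycle F c (x : oriented) : set oriented :=
  [set y | exists n, y = iter n (sigma_lift F c) x].

(* The superpotential [F]_L, given by any finite model of the quotient of the
   set of edges by L; only the values of sp_class on edges matter. *)
Record superpotential F L := Superpotential {
  sp_edge :> finType;
  sp_class : oriented -> sp_edge;
  sp_class_surj : forall e, exists2 x, edge F x & sp_class x = e;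
  sp_class_eq : forall x y, edge F x -> edge F y ->
    sp_class x = sp_class y <-> exists2 tau, L tau & y = translate tau x;
  sp_sigma : color -> {perm sp_edge};
  sp_sigmaE : forall c x, edge F x ->
    sp_class (sigma_lift F c x) = sp_sigma c (sp_class x) }.

End Zebra.

Arguments sp_class {R F L} s x.
Arguments sp_sigma {R F L} s c.

Section Weights.
Variables (R : realType) (F : plane R -> 'F_2) (L : set (plane R)).
Variable S : superpotential F L.

(* The polygon of colour c adjacent to e in the quotient tiling: w(e) for
   c = 0, b(e) for c = 1 *)
Definition sp_polygon (c : color) (e : S) : {set S} := porbit (sp_sigma S c) e.

Definition integer_weight (nu : S -> nat) (deg : nat) : Prop :=
  forall c e, (\sum_(f in sp_polygon c e) nu f)%N = deg.

Definition perfect_matching (m : S -> nat) : Prop := integer_weight m 1.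

Definition fractional_matching (theta : S -> R) : Prop :=
  (forall e, 0 < theta e) /\
  forall c e, \sum_(f in sp_polygon c e) theta f = 1.

End Weights.

Section Realizations.
Variables (R : realType) (F : plane R -> 'F_2) (L : set (plane R)).
Variable S : superpotential F L.
Notation oriented := (plane R * plane R)%type.
Implicit Types (c : color) (x y : oriented) (omega : S -> plane R).

(* In what follows pt maps the vertices of the tiling given by F to points of
   the plane, and the edge x is drawn as the segment from pt x.1 to pt x.2. *)
Implicit Type pt : plane R -> plane R.

Definition drawn_point pt x (r : R) : plane R :=
  pt x.1 + r *: (pt x.2 - pt x.1).

Definition drawn_boundary pt c x : set (plane R) :=
  [set z | exists y, sigma_cycle F c x y /\ exists2 r, 0 <= r <= 1 &
     z = drawn_point pt y r].

(* The interior of the closed curve drawn_boundary pt c x *)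
Definition drawn_interior pt c x : set (plane R) :=
  [set z | ~ drawn_boundary pt c x z /\
     bounded_set (connected_component (~` drawn_boundary pt c x) z)].

Record drawing omega pt : Prop := Drawing {
  drawing_edge : forall x, edge F x -> pt x.2 - pt x.1 = omega (sp_class S x);
  drawing_next : forall c x, edge F x -> pt (sigma_lift F c x).1 = pt x.2;
  drawing_vertex_inj : forall v w, vertex F v -> vertex F w ->
    pt v = pt w -> v = w;
  drawing_vertex_edge : forall v x (r : R), vertex F v -> edge F x ->
    0 < r < 1 -> pt v <> drawn_point pt x r;
  drawing_edge_disjoint : forall x y (r s : R), edge F x -> edge F y ->
    0 < r < 1 -> 0 < s < 1 -> drawn_point pt x r = drawn_point pt y s -> x = y;
  (* white polygons are traversed counter-clockwise, black ones clockwise *)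
  drawing_oriented : forall c x (r : R), edge F x -> 0 < r < 1 ->
    \forall h \near 0^'+, drawn_interior pt c x
      (drawn_point pt x r + h *: edge_normal c (pt x.2 - pt x.1));
  drawing_disjoint : forall c d x y z, edge F x -> edge F y ->
    drawn_interior pt c x z -> drawn_interior pt d y z ->
    c = d /\ sigma_cycle F c x y;
  drawing_cover : forall z, exists c x, edge F x /\
    (drawn_boundary pt c x `|` drawn_interior pt c x) z;
  drawing_periodic : exists2 h : plane R -> plane R,
    [/\ forall a b, L a -> L b -> h (a + b) = h a + h b,
        set_inj L h & lattice (h @` L)] &
    forall v a, vertex F v -> L a -> pt (v + a) = pt v + h a }.

Definition realization omega : Prop :=
  (forall e, omega e != 0) /\ exists pt, drawing omega pt.

Definition mark pt (theta : S -> R) c x : plane R :=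
  \sum_(y \in sigma_cycle F c x)
    theta (sp_class S y) *: (2^-1 *: (pt y.1 + pt y.2)).

(* The vertices s, b, t, w in cyclic order *)
Definition quadrangle pt theta x : seq (plane R) :=
  [:: pt x.1; mark pt theta 1 x; pt x.2; mark pt theta 0 x].

Definition drawn_polygon pt c x : seq (plane R) :=
  [seq pt y.1 | y <- traject (sigma_lift F c) x #|sp_polygon c (sp_class S x)|].

Definition weight_omega (nu1 nu2 nu3 : S -> nat) (e : S) : plane R :=
  vec2 ((nu1 e)%:R - (nu3 e)%:R) ((nu2 e)%:R - (nu3 e)%:R).

Definition weight_theta (nu : S -> nat) (deg : nat) (e : S) : R :=
  (nu e)%:R / deg%:R.

(* deg3 is the degree of nu3. *)
Definition weight_realization (nu1 nu2 nu3 : S -> nat) (deg3 : nat) : Prop :=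
  [/\ (exists deg1, integer_weight nu1 deg1) /\
      (exists deg2, integer_weight nu2 deg2) /\
      integer_weight nu3 deg3,
      forall e, [/\ (0 < nu1 e)%N, (0 < nu2 e)%N & (0 < nu3 e)%N],
      realization (weight_omega nu1 nu2 nu3) &
      forall pt x, drawing (weight_omega nu1 nu2 nu3) pt -> edge F x ->
        (forall c, strictly_convex (drawn_polygon pt c x)) /\
        strictly_convex (quadrangle pt (weight_theta nu3 deg3) x)].

End Realizations.

Section Matrices.
Variables (R : realType) (F : plane R -> 'F_2) (L : set (plane R)).
Variable S : superpotential F L.
Implicit Types (m : S -> nat) (theta : S -> R) (c : color).

(* Matrices indexed by S, through the enumeration of S *)

Definition varsigma_mx m c : 'M[R]_#|S| :=
  \matrix_(i, j) ((enum_val i == sp_sigma S c (enum_val j))%:R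
                  * (1 - (m (enum_val j))%:R)).

Definition rho_mx m c : 'M[R]_#|S| := invmx (1%:M - varsigma_mx m c).

Definition matching_row theta : 'rV[R]_#|S| := \row_i theta (enum_val i).

Definition indicator_row (p : {set S}) : 'rV[R]_#|S| :=
  \row_i (enum_val i \in p)%:R.

Definition mark_mx m theta c : 'M[R]_#|S| :=
  \matrix_(i < #|S|) (matching_row theta
    *m diag_mx (indicator_row (sp_polygon c (enum_val i)))
    *m (- (2^-1)%:M + rho_mx m c)).

Definition B_mx m theta := mark_mx m theta 1.
Definition W_mx m theta := mark_mx m theta 0.

Definition omega_mx (omega : S -> plane R) : 'M[R]_(#|S|, 2) :=
  \matrix_(i < #|S|) omega (enum_val i).

Definition quadrangle_formulas m theta (omega : S -> plane R)
    (pt : plane R -> plane R) (x : plane R * plane R) : Prop :=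
  let e := enum_rank (sp_class S x) in
  [/\ mark pt theta 1 x - pt x.1 =
        row e ((B_mx m theta + 1%:M - rho_mx m 1) *m omega_mx omega),
      mark pt theta 0 x - pt x.1 =
        row e ((W_mx m theta + 1%:M - rho_mx m 0) *m omega_mx omega) &
      pt x.2 - pt x.1 = row e (omega_mx omega)].

End Matrices.

(* Main.v *)
(* Let y run through the edges of the polygon of colour c along x. The entries
   of rho * omega add up omega along the boundary from the matched edge of the
   polygon, so the entry of y is pt y.2 - p0, where p0 is the target of the
   matched edge. Hence theta * (-1/2 + rho) * omega is the marked point minus p0,
   while the row of (1 - rho) * omega at x is p0 - pt x.1; the sum is the marked
   point minus pt x.1. This compares a boundary cycle of the plane with a cycle
   of sigma in the quotient: they correspond bijectively, since a translation
   which relates two edges of one bounded polygon preserves it, and is 0. *)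
Require Import Defs.
From mathcomp Require Import all_boot all_order all_algebra all_fingroup.
From mathcomp Require Import all_classical all_reals all_analysis.
From mathcomp Require Import ring lra.
Import Order.TTheory GRing.Theory Num.Theory.
Import numFieldNormedType.Exports.
Local Open Scope classical_set_scope.
Local Open Scope ring_scope.

Set Implicit Arguments.
Unset Strict Implicit.
Unset Printing Implicit Defensive.

(* mathcomp-analysis has its own [adjacent], for sequences. *)
Local Notation adjacent := Defs.adjacent.

(** * Polygons of the tiling under translations that preserve [F] *)

Section TilingGeometry.
Variable R : realType.
Implicit Types (F : plane R -> 'F_2) (c : color) (P L : set (plane R)).
Implicit Types (x y : plane R * plane R) (p tau : plane R).

Lemma region_addr F c tau p :
  Aut_zebra F tau -> region F c p -> region F c (p + tau).
Proof.
move=> Ftau Fp; apply/(nbhsDl [set x | F x = c] p tau).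
by apply: filterS Fp => q /= <-; rewrite Ftau.
Qed.

(** The translate of [P] by [tau] is connected, stays in the region and contains [p + tau], so it
    lies in the component of [p + tau], which is [P]. *)
Lemma polygon_addr F c P tau p q : polygon F c P -> Aut_zebra F tau ->
  P p -> P (p + tau) -> P q -> P (q + tau).
Proof.
move=> [z Fz ->] Ftau Pp Pptau Pq.
apply: connected_component_trans Pptau _.
have sub : [set q + tau | q in connected_component (region F c) z]
    `<=` connected_component (region F c) (p + tau).
  apply: connected_component_max.
  - by exists p.
  - move=> _ [r Pr <-]; apply: region_addr => //.
    exact: connected_component_sub Pr.
  - apply: connected_continuous_connected; first exact: component_connected.
    by apply: continuous_subspaceT => r; exact: (cvgD cvg_id (cvg_cst _)).
by apply: sub; exists q.
Qed.

Lemma bounded_addr_iter P p tau : bounded_set P ->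
  (forall k, P (p + tau *+ k)) -> tau = 0.
Proof.
(* [bounded_set] only provides the bounds strictly above [N]. *)
move=> [N [_ PN]] Ptau; set M := N + 1.
have PM q : P q -> `|q| <= M by apply: PN; rewrite ltrDl.
apply/eqP; rewrite -normr_le0 leNgt.
apply/negP => tau_gt0.
have M0 : 0 <= M by apply: le_trans (PM _ (Ptau 0)).
have := archi_boundP (divr_ge0 (addr_ge0 M0 M0) (ltW tau_gt0)).
set k := Num.bound _; rewrite ltr_pdivrMr // => lt_k.
have : `|tau *+ k| <= M + M.
  have -> : tau *+ k = (p + tau *+ k) - (p + tau *+ 0)
    by rewrite mulr0n addr0 addrC addKr.
  by apply: le_trans (ler_normB _ _) _; apply: lerD; apply: PM; exact: Ptau.
by rewrite leNgt -scaler_nat normrZ normr_nat lt_k.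
Qed.

Lemma polygon_addr_eq0 F c P tau p : convex_zebra F -> polygon F c P ->
  Aut_zebra F tau -> P p -> P (p + tau) -> tau = 0.
Proof.
move=> Fconv FP Ftau Pp Pptau.
apply: (@bounded_addr_iter P p); first by have [] := Fconv _ _ FP.
elim=> [|k IHk]; first by rewrite mulr0n addr0.
rewrite mulrSr addrA; exact: (polygon_addr FP Ftau Pp Pptau).
Qed.

Lemma polygon_eq F c P Q p : polygon F c P -> polygon F c Q -> P p -> Q p -> P = Q.
Proof.
move=> [a _ ->] [b _ ->] /same_connected_component -> /same_connected_component.
by [].
Qed.

Lemma adjacent_near_mid F c x P : adjacent F c x P ->
  \forall h \near 0^'+,
    P (x.1 + 2^-1 *: (x.2 - x.1) + h *: edge_normal c (x.2 - x.1)).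
Proof. by case=> _ /(_ 2^-1); apply; lra. Qed.

Lemma adjacent_uniq F c x P Q : adjacent F c x P -> adjacent F c x Q -> P = Q.
Proof.
move=> xP xQ.
have [h [Ph Qh]] := filter_ex
  (filterI (adjacent_near_mid xP) (adjacent_near_mid xQ)).
exact: polygon_eq (xP.1) (xQ.1) Ph Qh.
Qed.

(** For one small [h], the point at height [h] over the midpoint of [x] and its translate by [tau]
    both lie in [P]. *)
Lemma adjacent_translate_eq0 F c x P tau : convex_zebra F -> Aut_zebra F tau ->
  adjacent F c x P -> adjacent F c (translate tau x) P -> tau = 0.
Proof.
move=> Fconv Ftau xP txP.
have [h [Ph /= Pth]] := filter_ex
  (filterI (adjacent_near_mid xP) (adjacent_near_mid txP)).
apply: (polygon_addr_eq0 Fconv xP.1 Ftau Ph).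
move: Pth; have -> : x.2 + tau - (x.1 + tau) = x.2 - x.1.
  by rewrite opprD addrACA subrr addr0.
by rewrite -!addrA [tau + _]addrC !addrA.
Qed.

End TilingGeometry.

(** * Matched edges and the matrix [rho_mx] *)

Section Matching.
Variables (R : realType) (F : plane R -> 'F_2) (L : set (plane R)).
Variables (S : superpotential F L) (m : S -> nat).
Hypothesis pm : perfect_matching m.
Implicit Type c : color.

Lemma perfect_matching_ex c (e : S) : exists2 f, f \in sp_polygon c e & m f = 1%N.
Proof.
by have /eqP/sum_nat_eq1[f [ef mf _]] := pm c e; exists f.
Qed.

Lemma perfect_matching_uniq c (e f g : S) :
  f \in sp_polygon c e -> g \in sp_polygon c e -> m f = 1%N -> m g <> 0%N -> g = f.
Proof.
have /eqP/sum_nat_eq1[i [_ _ i0]] := pm c e.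
move=> ef eg mf mg.
have eq_i h : h \in sp_polygon c e -> m h <> 0%N -> h = i.
  by move=> eh mh; apply: contra_notP mh => /eqP hi; exact: i0.
by rewrite (eq_i _ eg mg) (eq_i f) // mf.
Qed.

Lemma perfect_matching_01 (e : S) : m e = 0%N \/ m e = 1%N.
Proof.
have := pm 0 e; rewrite (bigD1 e) ?porbit_id //=.
by case: (m e) => [|[|k]] // _; [left|right].
Qed.

(* A row u with u = u * varsigma vanishes at the matched edge of each polygon,
   hence, going backwards, along the whole boundary. *)
Lemma varsigma_unit c : (1%:M - varsigma_mx m c : 'M[R]_#|S|) \in unitmx.
Proof.
rewrite -row_free_unit; apply: inj_row_free => u.
rewrite mulmxBr mulmx1 => /eqP; rewrite subr_eq0 => /eqP uE.
have uS e : u 0 (enum_rank e) = u 0 (enum_rank (sp_sigma S c e)) * (1 - (m e)%:R).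
  rewrite {1}uE mxE (bigD1 (enum_rank (sp_sigma S c e))) //=.
  rewrite mxE !enum_rankK eqxx mul1r big1 ?addr0 // => i ne_i.
  rewrite mxE enum_rankK.
  case: eqP => [iE|_]; last by rewrite mul0r mulr0.
  by case/eqP: ne_i; rewrite -iE enum_valK.
apply/rowP => i; rewrite mxE -(enum_valK i); move: (enum_val i) => e.
have [f /porbitP[k ->]] := perfect_matching_ex c e.
elim: k e => [|k IHk] e mf; first by rewrite uS -[e](perm1) mf subrr mulr0.
by rewrite uS IHk ?mul0r // -permM -expgS.
Qed.

(** This is [v = omega + varsigma * v] read row by row: the rows of [v] accumulate [omega] along the
    boundary, and the sum restarts just after a matched edge. *)
Lemma rho_mxE c n (omega : 'M[R]_(#|S|, n)) e j :
  (rho_mx m c *m omega) (enum_rank (sp_sigma S c e)) j =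
  omega (enum_rank (sp_sigma S c e)) j
  + (1 - (m e)%:R) * (rho_mx m c *m omega) (enum_rank e) j.
Proof.
set v := rho_mx m c *m omega.
have : omega = v - varsigma_mx m c *m v.
  by rewrite -[X in X - _]mul1mx -mulmxBl mulmxA mulmxV ?varsigma_unit // mul1mx.
move: v => v ->; rewrite !mxE (bigD1 (enum_rank e)) //= mxE !enum_rankK eqxx mul1r.
rewrite big1 ?addr0 ?subrK // => i ne_i; rewrite mxE enum_rankK.
case: eqP => [/perm_inj eE|_]; last by rewrite !mul0r.
by case/eqP: ne_i; rewrite eE enum_valK.
Qed.

(** Each summand will be the midpoint of an edge relative to a base point: the row of [rho] leads to
    the target, and half an edge is taken back. *)
Lemma row_mark_mx (theta : S -> R) c e n (omega : 'M[R]_(#|S|, n)) :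
  row (enum_rank e) (mark_mx m theta c *m omega) =
  \sum_(f in sp_polygon c e) theta f *:
    (row (enum_rank f) (rho_mx m c *m omega) - 2^-1 *: row (enum_rank f) omega).
Proof.
apply/rowP => j; rewrite row_mul rowK enum_rankK -!mulmxA !mxE summxE.
rewrite (reindex_onto (@enum_rank S) (@enum_val S predT)) /=;
  last by move=> i _; exact: enum_valK.
under eq_bigl => f do rewrite enum_rankK eqxx.
rewrite [RHS]big_mkcond /=; apply: eq_bigr => f _.
rewrite mul_diag_mx mxE mulmxDl -scalemx1 mulNmx -scalemxAl mul1mx !mxE enum_rankK.
by case: (_ \in _); rewrite ?mul0r ?mulr0 // mul1r addrC.
Qed.

End Matching.

(** * Boundary cycles in the plane and in the quotient, and positions in a drawing *)

Section Drawing.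
Variables (R : realType) (F : plane R -> 'F_2) (L : set (plane R)).
Variables (S : superpotential F L) (omega : S -> plane R) (pt : plane R -> plane R).
Hypotheses (Fconv : convex_zebra F) (LAut : L `<=` Aut_zebra F).
Hypothesis pt_drawing : drawing omega pt.
Implicit Types (x y : plane R * plane R) (c : color).

(* If no edge followed x, then sigma_lift F c x would be x, and drawing_next
   would identify the two ends of x. *)
Lemma sigma_lift_follows c x : edge F x -> follows F c x (sigma_lift F c x).
Proof.
move=> Ex; apply: contrapT => nfx.
have sx : sigma_lift F c x = x.
  rewrite /sigma_lift; case: xgetP => // y _ fxy; case: nfx.
  by apply: xgetPex; exists y.
have [v1 v2 ne _ _] := Ex; apply: ne.
apply: (drawing_vertex_inj pt_drawing) => //.
by rewrite -(drawing_next pt_drawing c Ex) sx.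
Qed.

Lemma sigma_lift_edge c x : edge F x -> edge F (sigma_lift F c x).
Proof. by case/(sigma_lift_follows c). Qed.

Lemma iter_sigma_lift_edge c x k : edge F x -> edge F (iter k (sigma_lift F c) x).
Proof. by move=> Ex; elim: k => //= k; exact: sigma_lift_edge. Qed.

Lemma iter_sigma_lift_adjacent c x P k : edge F x -> adjacent F c x P ->
  adjacent F c (iter k (sigma_lift F c) x) P.
Proof.
move=> Ex xP; elim: k => //= k IHk.
have [_ _ [Q [Q1 Q2]]] := sigma_lift_follows c (iter_sigma_lift_edge c k Ex).
by rewrite (adjacent_uniq IHk Q1).
Qed.

Lemma sp_class_iter c x k : edge F x ->
  sp_class S (iter k (sigma_lift F c) x) = iter k (sp_sigma S c) (sp_class S x).
Proof.
by move=> Ex; elim: k => //= k <-; rewrite sp_sigmaE //; exact: iter_sigma_lift_edge.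
Qed.

(* Two edges of one polygon of the plane in the same class differ by a
   translation in L which preserves that polygon; it is 0 because the polygon
   is bounded. *)
Lemma sp_class_cycle_inj c x y z : edge F x -> sigma_cycle F c x y ->
  sigma_cycle F c x z -> sp_class S y = sp_class S z -> y = z.
Proof.
move=> Ex [i yE] [j zE].
have [_ _ _ _ /(_ c) [P xP]] := Ex.
have Ey : edge F y by rewrite yE; exact: iter_sigma_lift_edge.
have Ez : edge F z by rewrite zE; exact: iter_sigma_lift_edge.
have yP : adjacent F c y P by rewrite yE; exact: iter_sigma_lift_adjacent.
have zP : adjacent F c z P by rewrite zE; exact: iter_sigma_lift_adjacent.
case/(sp_class_eq S Ey Ez) => tau Ltau ztau.
rewrite ztau in zP; rewrite ztau (adjacent_translate_eq0 Fconv (LAut Ltau) yP zP).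
by case: y {yE Ey yP zP ztau} => a b; rewrite /translate !addr0.
Qed.

Lemma sigma_cycle_period c x : edge F x ->
  iter #|sp_polygon c (sp_class S x)| (sigma_lift F c) x = x.
Proof.
move=> Ex; apply: (sp_class_cycle_inj Ex).
- by eexists.
- by exists 0%N.
- by rewrite sp_class_iter // [LHS]iter_porbit.
Qed.

Lemma map_sp_class_traject c x n : edge F x ->
  map (sp_class S) (traject (sigma_lift F c) x n) =
  traject (sp_sigma S c) (sp_class S x) n.
Proof.
elim: n x => //= n IHn x Ex.
by rewrite IHn ?sp_sigmaE //; exact: sigma_lift_edge.
Qed.

Lemma sigma_cycle_traject c x : edge F x -> sigma_cycle F c x =
  [set` traject (sigma_lift F c) x #|sp_polygon c (sp_class S x)|].
Proof.
move=> Ex; set n := #|_|.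
have n0 : (0 < n)%N by rewrite /n (cardD1 (sp_class S x)) porbit_id.
apply/seteqP; split=> y /=; last by case/trajectP => k _ ->; exists k.
case=> k ->; apply/trajectP; exists (k %% n)%N; first by rewrite ltn_mod.
rewrite {1}(divn_eq k n) addnC iterD; congr iter.
by elim: (k %/ n)%N => //= q IHq; rewrite mulSn iterD IHq sigma_cycle_period.
Qed.

(** The listed edges are distinct because their classes are. *)
Lemma big_sigma_cycle (V : nmodType) c x (G : plane R * plane R -> V) : edge F x ->
  \sum_(y \in sigma_cycle F c x) G y =
  \sum_(y <- traject (sigma_lift F c) x #|sp_polygon c (sp_class S x)|) G y.
Proof.
move=> Ex; rewrite sigma_cycle_traject // -fsbig_seq //.
apply: (@map_uniq _ _ (sp_class S)).
by rewrite map_sp_class_traject // uniq_traject_porbit.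
Qed.

Lemma big_sp_polygon (V : nmodType) c x (G : S -> V) : edge F x ->
  \sum_(f in sp_polygon c (sp_class S x)) G f =
  \sum_(y <- traject (sigma_lift F c) x #|sp_polygon c (sp_class S x)|)
     G (sp_class S y).
Proof.
move=> Ex; rewrite -(big_map (sp_class S) predT) map_sp_class_traject //=.
rewrite big_uniq ?uniq_traject_porbit //=.
by apply: eq_bigl => f; rewrite porbit_traject.
Qed.

(** Going round [j] more times makes the exponent at least [j]; an induction along the cycle can
    then start at any chosen edge. *)
Lemma sigma_cycle_iter c x i j : edge F x ->
  exists k, iter i (sigma_lift F c) x = iter (k + j) (sigma_lift F c) x.
Proof.
move=> Ex; set n := #|sp_polygon c (sp_class S x)|.
have n0 : (0 < n)%N by rewrite /n (cardD1 (sp_class S x)) porbit_id.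
exists (i + j * n - j)%N.
rewrite subnK; last by rewrite (leq_trans (leq_pmulr j n0)) ?leq_addl.
rewrite iterD; congr iter.
by elim: j => //= q IHq; rewrite mulSn iterD -IHq sigma_cycle_period.
Qed.

Variable m : S -> nat.
Hypothesis pm : perfect_matching m.

(* The base point p0 is the target of the matched edge of the polygon. *)
Lemma row_rho_mx c x : edge F x -> exists p0, forall y, sigma_cycle F c x y ->
  row (enum_rank (sp_class S y)) (rho_mx m c *m omega_mx omega) = pt y.2 - p0.
Proof.
move=> Ex; set s := sigma_lift F c.
have [f fx mf] := perfect_matching_ex pm c (sp_class S x).
have /porbitP[a fE] := fx.
rewrite permX -sp_class_iter // in fE.
exists (pt (iter a s x).2) => _ [i ->]; set rho_omega := _ *m _.
(* The matched edge is [iter a s x]; the induction on [k] starts at the edge after it, where the sum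
   restarts. *)
have [k ->] := sigma_cycle_iter c i a.+1 Ex.
have cyc j : sigma_cycle F c x (iter j s x) by exists j.
have stepE y : edge F y ->
    row (enum_rank (sp_class S (s y))) rho_omega =
    pt (s y).2 - pt y.2 + (1 - (m (sp_class S y))%:R) *:
    row (enum_rank (sp_class S y)) rho_omega.
  move=> Ey; rewrite -(drawing_next pt_drawing c Ey).
  rewrite (drawing_edge pt_drawing) ?sp_sigmaE //; last exact: sigma_lift_edge.
  by apply/rowP => j; rewrite mxE [LHS]rho_mxE // !mxE enum_rankK.
elim: k => [|k IHk]; rewrite ?add0n ?addSn iterS stepE;
  try exact: iter_sigma_lift_edge.
  by rewrite -fE mf subrr scale0r addr0.
move: IHk; set y := iter _ _ x => IHk.
have yx : sp_class S y \in sp_polygon c (sp_class S x).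
  by rewrite sp_class_iter // -permX mem_porbit.
(* At an unmatched [y] the sum telescopes. A matched [y] is again [iter a s x], so the sum restarts
   from the same [p0]. *)
have [m0|m1] := perfect_matching_01 pm (sp_class S y).
  by rewrite m0 subr0 scale1r IHk addrA subrK.
rewrite m1 subrr scale0r addr0.
have -> // : y = iter a s x.
apply: (sp_class_cycle_inj Ex (cyc _) (cyc _)).
by rewrite -fE; apply: (perfect_matching_uniq pm fx yx mf); rewrite m1.
Qed.

Lemma row_quadrangle theta c x : fractional_matching theta -> edge F x ->
  mark pt theta c x - pt x.1 =
  row (enum_rank (sp_class S x))
    ((mark_mx m theta c + 1%:M - rho_mx m c) *m omega_mx omega).
Proof.
move=> [_ theta1] Ex; have [p0 rhoE] := row_rho_mx c Ex.
have rowE y : edge F y ->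
    row (enum_rank (sp_class S y)) (omega_mx omega) = pt y.2 - pt y.1.
  by move=> Ey; rewrite rowK enum_rankK (drawing_edge pt_drawing).
rewrite mulmxBl mulmxDl mul1mx !linearB !linearD /= row_mark_mx.
rewrite rowE // rhoE; last by exists 0%N.
set T := (X in _ = X + _ - _).
have -> : T = mark pt theta c x - p0.
  (* As [theta] sums to 1, [p0] can be moved inside the convex combination and compared edge by
     edge. *)
  have p0E : p0 = \sum_(f in sp_polygon c (sp_class S x)) theta f *: p0.
    by rewrite -scaler_suml theta1 scale1r.
  rewrite /mark big_sigma_cycle // [X in _ = _ - X]p0E.
  rewrite /T !big_sp_polygon // -sumrB !big_seq.
  apply: eq_bigr => y /trajectP[k _ ->].
  rewrite rowE; last exact: iter_sigma_lift_edge.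
  rewrite rhoE; last by exists k.
  by rewrite -scalerBr; congr (_ *: _); apply/rowP => j; rewrite !mxE; lra.
move: (mark _ _ _ _) => q; apply/rowP => j; rewrite !mxE; ring.
Qed.

Lemma quadrangle_formulas_drawing theta x : fractional_matching theta -> edge F x ->
  quadrangle_formulas m theta omega pt x.
Proof.
move=> th Ex; split; [exact: row_quadrangle..|].
by rewrite rowK enum_rankK (drawing_edge pt_drawing).
Qed.

End Drawing.

(** * From weight functions to fractional matchings *)

Lemma weight_theta_fractional (R : realType) (F : plane R -> 'F_2)
    (L : set (plane R)) (S : superpotential F L) (nu : S -> nat) (deg : nat) :
  integer_weight nu deg -> (forall e, (0 < nu e)%N) ->
  fractional_matching (weight_theta nu deg : S -> R).
Proof.
move=> nu_deg nu0.
(* An edge [e] is needed here: without edges, [deg] could be 0. *)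
have deg0 (e : S) : (0 < deg)%N.
  by rewrite -(nu_deg 0 e) (bigD1 e) ?porbit_id //= addn_gt0 nu0.
split=> [e|c e]; first by rewrite divr_gt0 // ltr0n ?nu0 ?(deg0 e).
rewrite -mulr_suml -natr_sum nu_deg divff //.
by rewrite pnatr_eq0 -lt0n (deg0 e).
Qed.

Unset Implicit Arguments.

Theorem proposition5p3 (R : realType) (F : plane R -> 'F_2)
    (L : set (plane R)) (S : superpotential F L) (m : S -> nat) :
  zhegalkin F -> convex_zebra F -> sublattice F L -> perfect_matching m ->
  (forall (omega : S -> plane R) (theta : S -> R),
     realization omega -> fractional_matching theta ->
     forall pt x, drawing omega pt -> edge F x ->
       quadrangle_formulas m theta omega pt x) /\
  (forall (nu1 nu2 nu3 : S -> nat) (deg3 : nat),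
     weight_realization nu1 nu2 nu3 deg3 ->
     forall pt x, drawing (weight_omega nu1 nu2 nu3) pt -> edge F x ->
       quadrangle_formulas m (weight_theta nu3 deg3)
         (weight_omega nu1 nu2 nu3) pt x).
Proof.
move=> _ Fconv [_ LAut] pm; split=> [omega theta _ th pt x dr Ex|].
  exact: quadrangle_formulas_drawing.
move=> nu1 nu2 nu3 deg3 [[_ [_ nu3_deg]] nu0 _ _] pt x dr Ex.
apply: quadrangle_formulas_drawing => //.
by apply: weight_theta_fractional => // e; have [] := nu0 e.
Qed.
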